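(* Let $a,b,c,d$ be fixed complex numbers with $c\neq 0$. Let $x=(x_n)_{n\in\mathbb{N}}$ be a sequence and let $y=\mathscr{Y}_{a,b,c,d}(x)$, that is, \[ y_n=\sum_{k=1}^n \frac{1}{n!}\bigg[\prod_{j=1}^{k-1}(an+bk+cj+d)\bigg]B_{n,k}(1!x_1,2!x_2,\dots)\quad\text{for } n\ge 1. \] Then for every $n\in\mathbb{N}$ and every $\lambda\in\mathbb{C}$, \[ \sum_{k=1}^n \bigg[\prod_{j=1}^{k-1}(\lambda-dj+d)\bigg]B_{n,k}(1!y_1,2!y_2,\dots) =\sum_{k=1}^n \bigg[\prod_{j=1}^{k-1}(an+bk+cj+d+\lambda)\bigg] B_{n,k}(1!x_1,2!x_2,\dots). \]
   Context: For $k\ge 0$, the (exponential) partial Bell polynomials $B_{n,k}(z_1,z_2,\dots)$ are defined by $\frac{1}{k!}\big(\sum_{j\ge1} z_j \frac{t^j}{j!}\big)^k=\sum_{n\ge k}B_{n,k}(z_1,z_2,\dots)\frac{t^n}{n!}$; equivalently $B_{n,k}=\sum \frac{n!}{\alpha_1!\alpha_2!\cdots}\prod_i (z_i/i!)^{\alpha_i}$, summed over $\alpha\in\mathbb{N}_0^{n-k+1}$ with $\sum\alpha_i=k$ and $\sum i\alpha_i=n$. An empty product equals $1$. For parameters $a,b,c,d$, the Bell transform $\mathscr{Y}_{a,b,c,d}$ maps a sequence $x$ to the sequence $y$ given by the displayed formula. *)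

(* Defs.v *)
From mathcomp Require Import all_boot all_order all_algebra.

Set Implicit Arguments.
Unset Strict Implicit.
Unset Printing Implicit Defensive.

Import GRing.Theory.
Local Open Scope ring_scope.

(* A formal power series over K is represented by its coefficient sequence. *)
Definition fps_one (K : fieldType) : nat -> K := fun n => (n == 0%N)%:R.

Definition fps_mul (K : fieldType) (f g : nat -> K) : nat -> K :=
  fun n => \sum_(i < n.+1) f i * g (n - i)%N.

Definition fps_exp (K : fieldType) (f : nat -> K) (k : nat) : nat -> K :=
  iter k (fps_mul f) (fps_one K).

(* \sum_(j >= 1) z_j t^j / j!; the value z 0 is never used. *)
Definition egf (K : fieldType) (z : nat -> K) : nat -> K :=
  fun j => if j == 0%N then 0 else z j / (j`!)%:R.

(* n! times the coefficient of t^n in (1/k!) (\sum_(j >= 1) z_j t^j / j!)^k;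
   this coefficient vanishes when n < k. *)
Definition bell (K : fieldType) (n k : nat) (z : nat -> K) : K :=
  (n`!)%:R * ((k`!)%:R^-1 * fps_exp (egf z) k n).

(* Sequences indexed by the positive integers are functions on nat whose value
   at 0 is irrelevant. *)
Definition bell_transform (K : fieldType) (a b c d : K) (x : nat -> K) :
    nat -> K := fun n =>
  \sum_(1 <= k < n.+1)
     (n`!)%:R^-1 *
     (\prod_(1 <= j < k) (a * n%:R + b * k%:R + c * j%:R + d)) *
     bell n k (fun i => (i`!)%:R * x i).

(* Main.v *)
From HB Require Import structures.
Require Import Defs.
From mathcomp Require Import all_boot all_algebra.
From mathcomp Require Import boolp functions reals complex.
From mathcomp Require Import ring.

(** Call polynomials [q_n] of convolution type if [Q(u) = sum_n q_n(u) t^n]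
    satisfies [Q(u + v) = Q(u) Q(v)], with [q_0 = 1] and [u | q_n(u)] for
    [n >= 1].  This property is stable under substituting a power series for
    [t].  It is also stable under twisting by [a], which replaces [q_n(u)] by
    [u / (u + a n) q_n(u + a n)]: by Lagrange inversion this amounts to
    substituting the compositional inverse of [t Q(- a)] for [t].

    Starting from [u (u + c) ... (u + (n - 1) c) / n!], twisting by [b],
    substituting [sum_j x_j t^j] and twisting by [a] gives the right-hand side
    of the theorem, multiplied by [u = lambda + d] and divided by [n!].  The
    left-hand side comes likewise from [u (u - d) ... (u - (n - 1) d) / n!] and
    [sum_j y_j t^j].

    The logarithmic derivative [w] in [t Q'(u) = u w Q(u)] does not depend on
    [u].  Hence [n q_n(u) / u] is the sum of the constant [w_n] and of terms
    given by [q_1, ..., q_{n-1}], and the family is determined by the values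
    [q_n(u) / u] at a single point; at [u = d] both sides give [y_n]. *)

Set Implicit Arguments.
Unset Strict Implicit.
Unset Printing Implicit Defensive.

Import GRing.Theory Num.Theory.
Local Open Scope ring_scope.

(* The alias carries the convolution product; [nat -> K] itself is already
   equipped with the pointwise one. *)
Definition fps (K : fieldType) := nat -> K.

Definition fps_of_poly (K : fieldType) (p : {poly K}) : fps K := fun n => p`_n.

Definition fps_trunc (K : fieldType) (n : nat) (f : fps K) : {poly K} :=
  \poly_(i < n.+1) f i.

Section FpsAlgebra.
Variable K : fieldType.
Implicit Types f g h : fps K.

Lemma fps_truncE n f i : (i <= n)%N -> fps_of_poly (fps_trunc n f) i = f i.
Proof. by move=> le_in; rewrite /fps_of_poly coef_poly ltnS le_in. Qed.

Lemma eq_fps_mul n f f' g g' :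
    (forall i, (i <= n)%N -> f i = f' i) ->
    (forall i, (i <= n)%N -> g i = g' i) ->
  fps_mul f g n = fps_mul f' g' n.
Proof.
by move=> ff' gg'; apply: eq_bigr => i _; rewrite ff' ?gg' ?leq_subr // -ltnS.
Qed.

Lemma fps_of_polyM (p q : {poly K}) :
  fps_mul (fps_of_poly p) (fps_of_poly q) = fps_of_poly (p * q).
Proof. by apply/funext => n; rewrite [RHS]coefM. Qed.

Lemma fps_mul_trunc n f g i : (i <= n)%N ->
  fps_mul f g i = fps_of_poly (fps_trunc n f * fps_trunc n g) i.
Proof.
move=> le_in; rewrite -fps_of_polyM.
by apply: eq_fps_mul => j le_ji; rewrite fps_truncE ?(leq_trans le_ji).
Qed.

Lemma fps_mulC : commutative (@fps_mul K).
Proof.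
by move=> f g; apply/funext => n; rewrite !(@fps_mul_trunc n) // mulrC.
Qed.

Lemma fps_mulA : associative (@fps_mul K).
Proof.
move=> f g h; apply/funext => n; pose T := @fps_trunc K n.
transitivity (fps_of_poly (T f * (T g * T h)) n).
  rewrite -fps_of_polyM; apply: eq_fps_mul => i le_in.
    by rewrite fps_truncE.
  exact: fps_mul_trunc.
rewrite mulrA -fps_of_polyM; apply: eq_fps_mul => i le_in.
  by rewrite -fps_mul_trunc.
by rewrite fps_truncE.
Qed.

Lemma fps_mul1 : left_id (fps_one K) (@fps_mul K).
Proof.
move=> f; apply/funext => n; rewrite /fps_mul big_ord_recl mul1r subn0.
by rewrite big1 ?addr0 // => i _; rewrite mul0r.
Qed.

HB.instance Definition _ := GRing.Lmodule.copy (fps K) (nat -> K^o).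

Lemma coef_fpsD f g n : (f + g) n = f n + g n. Proof. by []. Qed.

Lemma coef_fpsZ (a : K) f n : (a *: f) n = a * f n. Proof. by []. Qed.

Lemma fps_mulDl :
  left_distributive (@fps_mul K) (+%R : fps K -> fps K -> fps K).
Proof.
move=> f g h; apply/funext => n; rewrite coef_fpsD /fps_mul -big_split.
by apply: eq_bigr => i _; rewrite mulrDl.
Qed.

Lemma fps_one_neq0 : fps_one K != (0 : fps K).
Proof. by apply/eqP => /(congr1 (@^~ 0%N))/eqP; rewrite oner_eq0. Qed.

HB.instance Definition _ := GRing.Zmodule_isComNzRing.Build (fps K)
  fps_mulA fps_mulC fps_mul1 fps_mulDl fps_one_neq0.

Lemma fps_scaleAl (a : K) f g : a *: (f * g) = (a *: f) * g.
Proof.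
apply/funext => n; rewrite coef_fpsZ mulr_sumr.
by apply: eq_bigr => i _; rewrite mulrA.
Qed.

HB.instance Definition _ :=
  GRing.Lmodule_isLalgebra.Build K (fps K) fps_scaleAl.
HB.instance Definition _ := GRing.Lalgebra_isComAlgebra.Build K (fps K).

Lemma fps_expE f k : fps_exp f k = f ^+ k.
Proof. by elim: k => // k IHk; rewrite exprS -IHk. Qed.

Lemma coef_fpsM f g n : (f * g) n = \sum_(i < n.+1) f i * g (n - i)%N.
Proof. by []. Qed.

Lemma coef0_fpsM f g : (f * g) 0%N = f 0%N * g 0%N.
Proof. by rewrite coef_fpsM big_ord1. Qed.

Lemma coef_fps_sum (I : Type) (r : seq I) (P : pred I) (F : I -> fps K) n :
  (\sum_(i <- r | P i) F i) n = \sum_(i <- r | P i) F i n.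
Proof. exact: (big_morph (fun f : fps K => f n)). Qed.

Definition fpsX : fps K := fps_of_poly 'X.

Lemma fpsX_exp i : fpsX ^+ i = fps_of_poly 'X^i.
Proof.
elim: i => [|i IHi]; first by apply/funext => n; rewrite [RHS]coef1.
by rewrite !exprS IHi; apply: fps_of_polyM.
Qed.

Lemma coef_fpsXnM i f n :
  (fpsX ^+ i * f) n = if (n < i)%N then 0 else f (n - i)%N.
Proof.
rewrite fpsX_exp; transitivity (fps_of_poly ('X^i * fps_trunc n f) n).
  by rewrite -fps_of_polyM; apply: eq_fps_mul => // j le_jn; rewrite fps_truncE.
by rewrite [LHS]coefXnM; case: ltnP => // _; apply/fps_truncE/leq_subr.
Qed.

Lemma coef0_fpsXM f : (fpsX * f) 0%N = 0.
Proof. by rewrite -[fpsX]expr1 coef_fpsXnM. Qed.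

Lemma coefS_fpsXM f n : (fpsX * f) n.+1 = f n.
Proof. by rewrite -[fpsX]expr1 coef_fpsXnM subn1. Qed.

Lemma coef_fps_exp_small h k n : h 0%N = 0 -> (n < k)%N -> (h ^+ k) n = 0.
Proof.
move=> h0; elim: k n => // k IHk n lt_nk; rewrite exprS coef_fpsM.
rewrite big1 // => -[[|i] lt_in] _; first by rewrite h0 mul0r.
rewrite IHk ?mulr0 // (leq_trans _ (lt_nk : n <= k)%N) // ltn_subrL.
exact: leq_ltn_trans (leq0n i) lt_in.
Qed.

Lemma fps_diag_mul_inj (u : nat -> fps K) f g : (forall n, u n 0%N != 0) ->
  (forall n, (f * u n) n = (g * u n) n) -> f = g.
Proof.
move=> u0 fug; apply/funext; elim/ltn_ind => n IHn.
apply: (mulIf (u0 n)); have := fug n.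
rewrite !coef_fpsM !big_ord_recr /= subnn.
by under eq_bigr do rewrite IHn //; move/addrI.
Qed.
End FpsAlgebra.

Section Theta.
Variable K : fieldType.
Implicit Types f g : fps K.

Definition theta f : fps K := fun n => n%:R * f n.

Lemma coef0_theta f : theta f 0%N = 0. Proof. exact: mul0r. Qed.

Lemma theta1 : theta 1 = 0.
Proof. by apply/funext => -[|n]; [apply: coef0_theta | apply: mulr0]. Qed.

Lemma thetaM f g : theta (f * g) = theta f * g + f * theta g.
Proof.
apply/funext => n; rewrite coef_fpsD !coef_fpsM /theta coef_fpsM mulr_sumr.
rewrite -big_split; apply: eq_bigr => i _ /=.
by rewrite -{1}(subnKC (leq_ord i)) natrD; ring.
Qed.

Lemma thetaX f n : theta (f ^+ n) = (f ^+ n.-1 * theta f) *+ n.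
Proof.
elim: n => [|n IHn]; first exact: theta1.
rewrite exprS thetaM IHn mulrnAr mulrA -exprS mulrS mulrC.
by case: n {IHn} => //= n; rewrite !mulr0n.
Qed.

Lemma theta_inverse f g : f * g = 1 -> f * theta g = - (g * theta f).
Proof.
move=> fg1; apply/eqP; rewrite -addr_eq0 [g * _]mulrC addrC -thetaM fg1.
by rewrite theta1.
Qed.
End Theta.

Section Composition.
Variable K : fieldType.
Implicit Types f g h : fps K.

Definition fps_comp f h : fps K := fun n => \sum_(k < n.+1) f k * (h ^+ k) n.

Lemma eq_fps_comp n f g h : (forall i, (i <= n)%N -> f i = g i) ->
  fps_comp f h n = fps_comp g h n.
Proof. by move=> fg; apply: eq_bigr => i _; rewrite fg // -ltnS. Qed.

Lemma fps_comp_widen f h n N : h 0%N = 0 -> (n < N)%N ->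
  fps_comp f h n = \sum_(k < N) f k * (h ^+ k) n.
Proof.
move=> h0 lt_nN; rewrite /fps_comp.
rewrite (big_ord_widen N (fun k => f k * (h ^+ k) n)) // big_mkcond.
apply: eq_bigr => k _; case: ltnP => // lt_nk.
by rewrite coef_fps_exp_small ?mulr0.
Qed.

Lemma fps_comp_poly h (p : {poly K}) : h 0%N = 0 ->
  fps_comp (fps_of_poly p) h = horner_alg h p.
Proof.
move=> h0; apply/funext => n; pose N := maxn (size p) n.+1.
rewrite (@fps_comp_widen _ _ _ N) ?leq_maxr // /horner_alg /horner_morph.
rewrite (@horner_coef_wide _ N) ?coef_fps_sum; last first.
  by rewrite (leq_trans (size_poly _ _)) ?leq_maxl.
by apply: eq_bigr => k _; rewrite coef_map mulr_algl.
Qed.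

Lemma fps_comp_trunc n f h i : h 0%N = 0 -> (i <= n)%N ->
  fps_comp f h i = horner_alg h (fps_trunc n f) i.
Proof.
move=> h0 le_in; rewrite -fps_comp_poly //; apply: eq_fps_comp => j le_ji.
by rewrite fps_truncE // (leq_trans le_ji).
Qed.

Lemma fps_compM f g h : h 0%N = 0 ->
  fps_comp (f * g) h = fps_comp f h * fps_comp g h.
Proof.
move=> h0; apply/funext => n; pose T := @fps_trunc K n.
transitivity (horner_alg h (T f * T g) n).
  by rewrite -fps_comp_poly //; apply: eq_fps_comp => i; apply: fps_mul_trunc.
rewrite rmorphM; apply: eq_fps_mul => i le_in.
  by rewrite (fps_comp_trunc f h0 le_in).
by rewrite (fps_comp_trunc g h0 le_in).
Qed.

Lemma coef_fps_compM f g h n : h 0%N = 0 ->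
  (fps_comp f h * g) n = \sum_(i < n.+1) f i * (h ^+ i * g) n.
Proof.
move=> h0.
transitivity (((\sum_(k < n.+1) f k *: h ^+ k) * g) n).
  apply: eq_fps_mul => // i le_in.
  by rewrite coef_fps_sum (@fps_comp_widen _ _ _ n.+1).
rewrite mulr_suml coef_fps_sum; apply: eq_bigr => k _.
by rewrite -scalerAl.
Qed.
End Composition.

Section LagrangeInversion.
Variable K : numFieldType.
Variables psi psiV : fps K.
Hypothesis psi_psiV : psi * psiV = 1.
Implicit Types f g : fps K.

Definition lagrange_kernel n : fps K := psi ^+ n * (1 + psi * theta psiV).

(* With [h = t psiV = t / psi], this is the coefficient of [t^n] in
   [f psi^n (t h' / h)]: the Lagrange-Buermann formula for the composite of [f]
   with the compositional inverse of [h]. *)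
Definition lagrange f : fps K := fun n => (f * lagrange_kernel n) n.

Lemma coef0_lagrange_kernel n : lagrange_kernel n 0%N != 0.
Proof.
rewrite /lagrange_kernel coef0_fpsM coef_fpsD coef0_fpsM coef0_theta.
rewrite mulr0 addr0 mulr1.
elim: n => [|n IHn]; first by rewrite expr0 oner_neq0.
rewrite exprS coef0_fpsM mulf_neq0 //; apply/eqP => psi0.
have := congr1 (@^~ 0%N) psi_psiV; rewrite /= coef0_fpsM psi0 mul0r.
by move/eqP; rewrite eq_sym oner_eq0.
Qed.

(* [n psi^n (t h' / h) = n psi^n - theta (psi^n)], and [theta] multiplies the
   coefficient of [t^n] by [n]. *)
Lemma coef_lagrange_kernel n : lagrange_kernel n n = (n == 0%N)%:R.
Proof.
case: n => [|n].
  rewrite /lagrange_kernel mul1r coef_fpsD coef0_fpsM coef0_theta.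
  by rewrite mulr0 addr0.
have -> : lagrange_kernel n.+1 = psi ^+ n.+1 - psi ^+ n * theta psi.
  rewrite /lagrange_kernel theta_inverse // mulrDr mulr1 mulrN mulrA exprSr.
  by rewrite -(mulrA _ psi) psi_psiV mulr1.
apply: (@mulfI _ n.+1%:R); first by rewrite pnatr_eq0.
rewrite mulr0 -coef_fpsZ scalerBr !scaler_nat -(thetaX psi n.+1) -scaler_nat.
exact: subrr.
Qed.

Lemma lagrange_kernel_shift i n : (i <= n)%N ->
  (fpsX K * psiV) ^+ i * lagrange_kernel n =
  fpsX K ^+ i * lagrange_kernel (n - i).
Proof.
move=> le_in; rewrite /lagrange_kernel -{1}(subnKC le_in) exprD exprMn -!mulrA.
by congr (_ * _); rewrite mulrA -exprMn [psiV * _]mulrC psi_psiV expr1n mul1r.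
Qed.

Lemma lagrangeK g : lagrange (fps_comp g (fpsX K * psiV)) = g.
Proof.
apply/funext => n; rewrite /lagrange coef_fps_compM ?coef0_fpsXM //.
under eq_bigr => i _ do rewrite lagrange_kernel_shift ?leq_ord // coef_fpsXnM
  ltnNge leq_ord /= coef_lagrange_kernel subn_eq0.
rewrite big_ord_recr /= leqnn mulr1 big1 ?add0r // => i _.
by rewrite leqNgt ltn_ord mulr0.
Qed.

Lemma lagrange_inj : injective lagrange.
Proof.
move=> f g eq_fg; apply: (fps_diag_mul_inj coef0_lagrange_kernel) => n.
exact: (congr1 (@^~ n) eq_fg).
Qed.

Lemma fps_comp_lagrange f : fps_comp (lagrange f) (fpsX K * psiV) = f.
Proof. exact/lagrange_inj/lagrangeK. Qed.

Lemma lagrangeM f g : lagrange (f * g) = lagrange f * lagrange g.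
Proof.
rewrite -{1}(fps_comp_lagrange f) -{1}(fps_comp_lagrange g) -fps_compM.
  exact: lagrangeK.
exact: coef0_fpsXM.
Qed.
End LagrangeInversion.

Lemma poly_eq_nat (R : numDomainType) (p q : {poly R}) :
  (forall m : nat, p.[m%:R] = q.[m%:R]) -> p = q.
Proof.
move=> pq; apply/eqP; rewrite -subr_eq0; apply/eqP.
apply: (@roots_geq_poly_eq0 _ _ [seq m%:R | m <- iota 0 (size (p - q))]).
- by apply/allP => _ /mapP[m _ ->]; rewrite /root !hornerE pq subrr.
- by rewrite map_inj_uniq ?iota_uniq //; apply: mulrIn; rewrite oner_eq0.
- by rewrite size_map size_iota.
Qed.

Lemma factr_neq0 (R : numDomainType) n : (n`!)%:R != 0 :> R.
Proof. by rewrite pnatr_eq0 -lt0n fact_gt0. Qed.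

Section ConvolutionType.
Variable K : numFieldType.
Implicit Types (g : nat -> {poly K}) (u v : K).

(* The value at [u] of [sum_n q_n(u) t^n], where [q_0 = 1] and
   [q_n(u) = u g_n(u)] for [n >= 1]; [g_0] is never used. *)
Definition conv_series g u : fps K :=
  fun n => if n == 0%N then 1 else u * (g n).[u].

Definition conv_type g : Prop :=
  forall u v, conv_series g (u + v) = conv_series g u * conv_series g v.

Definition conv_poly g (n : nat) : {poly K} := if n == 0%N then 1 else 'X * g n.

Lemma horner_conv_poly g n u : (conv_poly g n).[u] = conv_series g u n.
Proof.
by rewrite /conv_poly /conv_series; case: eqP => _; rewrite !hornerE.
Qed.

Lemma conv_series0 g : conv_series g 0 = 1.
Proof. by apply/funext => -[|n] //; rewrite /conv_series mul0r. Qed.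

Lemma conv_seriesN g u : conv_type g ->
  conv_series g u * conv_series g (- u) = 1.
Proof. by move=> cg; rewrite -cg subrr conv_series0. Qed.

Lemma conv_seriesMn g u n : conv_type g ->
  conv_series g (u * n%:R) = conv_series g u ^+ n.
Proof.
move=> cg; elim: n => [|n IHn]; first by rewrite mulr0 conv_series0.
by rewrite -natr1 mulrDr mulr1 cg IHn exprSr.
Qed.

Definition log_deriv g : fps K := theta (conv_series g 1) * conv_series g (- 1).

Lemma theta_conv_series_nat g (m : nat) : conv_type g ->
  theta (conv_series g m%:R) = m%:R *: (log_deriv g * conv_series g m%:R).
Proof.
move=> cg; rewrite -[m%:R]mul1r conv_seriesMn // thetaX mul1r scaler_nat.
case: m => // m; congr (_ *+ _); rewrite exprS /log_deriv -mulrA mulrC.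
rewrite (mulrA (conv_series g (- 1))) (mulrC (conv_series g (- 1))).
by rewrite conv_seriesN // mul1r.
Qed.

(* Both sides times [u] are polynomials in [u] that agree at all naturals. *)
Lemma conv_type_recurrence g n u : conv_type g ->
  n%:R * (g n).[u] = (log_deriv g * conv_series g u) n.
Proof.
move=> cg; pose p := \sum_(i < n.+1) log_deriv g i *: conv_poly g (n - i).
have pE v : p.[v] = (log_deriv g * conv_series g v) n.
  rewrite horner_sum; apply: eq_bigr => i _.
  by rewrite hornerZ horner_conv_poly.
rewrite -pE -hornerZ; congr horner.
apply: (@mulfI _ 'X); first by rewrite polyX_eq0.
apply: poly_eq_nat => m; rewrite !hornerM hornerX hornerZ pE.
rewrite -coef_fpsZ -theta_conv_series_nat // /theta /conv_series.
by case: eqP => [->|_]; rewrite ?mul0r ?mulr0 // mulrCA.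
Qed.

Lemma log_derivE g n : conv_type g -> log_deriv g n = n%:R * (g n).[0].
Proof. by move=> cg; rewrite conv_type_recurrence // conv_series0 mulr1. Qed.

Lemma theta_conv_series g u : conv_type g ->
  theta (conv_series g u) = u *: (log_deriv g * conv_series g u).
Proof.
move=> cg; apply/funext => n.
rewrite coef_fpsZ -conv_type_recurrence // /theta /conv_series.
by case: eqP => [->|_]; rewrite ?mul0r ?mulr0 // mulrCA.
Qed.

Definition twist (a : K) g : nat -> {poly K} :=
  fun n => g n \Po ('X + (a * n%:R)%:P).

Lemma conv_series_twist (a u : K) g : conv_type g ->
  conv_series (twist a g) u =
  lagrange (conv_series g a) (conv_series g (- a)) (conv_series g u).
Proof.
move=> cg; apply/funext => n; pose s := u + a * n%:R.
have thetaNE : conv_series g a * theta (conv_series g (- a)) =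
    - (a *: log_deriv g).
  rewrite theta_conv_series // -scalerAr mulrCA conv_seriesN // mulr1.
  exact: scaleNr.
have -> : lagrange (conv_series g a) (conv_series g (- a)) (conv_series g u) n =
    conv_series g s n - a * (log_deriv g * conv_series g s) n.
  rewrite /lagrange /lagrange_kernel thetaNE mulrA -conv_seriesMn // -cg.
  by rewrite mulrBr mulr1 -scalerAr [_ * log_deriv g]mulrC.
rewrite -conv_type_recurrence // /conv_series /twist.
case: eqP => [->|_]; first by rewrite mul0r mulr0 subr0.
by rewrite horner_comp hornerD hornerX hornerC /s; ring.
Qed.

Lemma conv_type_twist (a : K) g : conv_type g -> conv_type (twist a g).
Proof.
by move=> cg u v; rewrite !conv_series_twist // cg lagrangeM // conv_seriesN.
Qed.

Definition family_comp g (h : fps K) : nat -> {poly K} :=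
  fun n => \sum_(1 <= k < n.+1) (h ^+ k) n *: g k.

Lemma conv_series_comp g (h : fps K) u :
  conv_series (family_comp g h) u = fps_comp (conv_series g u) h.
Proof.
apply/funext => n; rewrite /fps_comp big_ord_recl mul1r expr0.
rewrite {1}/conv_series; case: n => [|n] /=; first by rewrite big_ord0 addr0.
rewrite [X in _ = X + _](_ : _ = 0) // add0r /family_comp horner_sum.
rewrite big_add1 big_mkord mulr_sumr.
by apply: eq_bigr => k _; rewrite hornerZ mulrCA mulrC.
Qed.

Lemma conv_type_comp g (h : fps K) : h 0%N = 0 ->
  conv_type g -> conv_type (family_comp g h).
Proof. by move=> h0 cg u v; rewrite !conv_series_comp cg fps_compM. Qed.

Definition rising (c : K) (k : nat) : {poly K} :=
  (k`!)%:R^-1 *: \prod_(1 <= j < k) ('X + (c * j%:R)%:P).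

Lemma conv_series_risingS c u n :
  n.+1%:R * conv_series (rising c) u n.+1 =
  (u + c * n%:R) * conv_series (rising c) u n.
Proof.
rewrite /conv_series /rising /=; case: n => [|n] /=.
  by rewrite big_geq // hornerZ hornerC invr1; ring.
rewrite !hornerZ big_nat_recr //= factS natrM hornerM hornerD hornerX hornerC.
by field; rewrite factr_neq0 -natrD pnatr_eq0.
Qed.

Lemma theta_conv_series_rising c u :
  theta (conv_series (rising c) u) =
  fpsX K *
    (u *: conv_series (rising c) u + c *: theta (conv_series (rising c) u)).
Proof.
apply/funext => -[|n]; first by rewrite coef0_theta coef0_fpsXM.
rewrite coefS_fpsXM /theta conv_series_risingS coef_fpsD !coef_fpsZ.
by rewrite mulrDl mulrA.
Qed.

Lemma conv_series_rising_uniq c u (f : fps K) : f 0%N = 1 ->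
  theta f = fpsX K * (u *: f + c *: theta f) -> f = conv_series (rising c) u.
Proof.
move=> f0 thetaE; apply/funext; elim=> [|n IHn]; first by rewrite f0.
apply: (@mulfI _ n.+1%:R); first by rewrite pnatr_eq0.
rewrite conv_series_risingS -IHn.
have /(congr1 (@^~ n.+1)) /= := thetaE.
rewrite coefS_fpsXM coef_fpsD !coef_fpsZ /theta => ->.
by rewrite mulrDl mulrA.
Qed.

Lemma conv_type_rising (c : K) : conv_type (rising c).
Proof.
move=> u v; symmetry; apply: conv_series_rising_uniq.
  by rewrite coef0_fpsM mulr1.
rewrite thetaM; set F := conv_series _ u; set G := conv_series _ v.
have thetaF : theta F = fpsX K * (u%:A * F + c%:A * theta F).
  by rewrite !mulr_algl -theta_conv_series_rising.
have thetaG : theta G = fpsX K * (v%:A * G + c%:A * theta G).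
  by rewrite !mulr_algl -theta_conv_series_rising.
rewrite -(mulr_algl (u + v)) -(mulr_algl c) scalerDl mulrDr.
rewrite {1}thetaF {1}thetaG; ring.
Qed.

Lemma conv_type_eq_at (d : K) g g' : conv_type g -> conv_type g' ->
    (forall n, (0 < n)%N -> (g n).[d] = (g' n).[d]) ->
  forall n, (0 < n)%N -> g n = g' n.
Proof.
move=> cg cg' gd; elim/ltn_ind => n IHn n_gt0.
have series_eq u i : (i < n)%N -> conv_series g u i = conv_series g' u i.
  by case: i => // i lt_in; rewrite /conv_series IHn.
have log_deriv_eq i : (i < n)%N -> log_deriv g i = log_deriv g' i.
  by case: i => [|i] lt_in; rewrite !log_derivE ?mul0r // IHn.
have diff_const u :
    n%:R * ((g n).[u] - (g' n).[u]) = log_deriv g n - log_deriv g' n.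
  rewrite mulrBr !conv_type_recurrence // !coef_fpsM !big_ord_recr /= subnn.
  rewrite !mulr1 opprD addrACA -sumrB big1 ?add0r // => -[[|i] lt_in] _ /=.
    by rewrite !log_derivE // !mul0r subrr.
  by rewrite log_deriv_eq // series_eq ?subrr // ltn_subrL.
apply: poly_eq_nat => m; apply/eqP; rewrite -subr_eq0; apply/eqP.
apply: (@mulfI _ n%:R); first by rewrite pnatr_eq0 -lt0n.
by rewrite diff_const -(diff_const d) gd // subrr.
Qed.
End ConvolutionType.

Definition ogf (K : fieldType) (x : nat -> K) : fps K :=
  fun j => if j == 0%N then 0 else x j.

Lemma egf_fact (K : numFieldType) (x : nat -> K) :
  egf (fun i => (i`!)%:R * x i) = ogf x.
Proof.
apply/funext => j; rewrite /egf /ogf; case: eqP => // _.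
by rewrite mulrC mulKf // factr_neq0.
Qed.

Section BellFamily.
Variable K : numFieldType.
Implicit Types (a b c d u : K) (x : nat -> K).

Definition bell_family a b c x : nat -> {poly K} :=
  twist a (family_comp (twist b (rising c)) (ogf x)).

Lemma conv_type_bell_family a b c x : conv_type (bell_family a b c x).
Proof.
apply/conv_type_twist/conv_type_comp => //.
exact/conv_type_twist/conv_type_rising.
Qed.

Lemma horner_bell_family a b c x n u :
  (n`!)%:R * (bell_family a b c x n).[u] =
  \sum_(1 <= k < n.+1)
     (\prod_(1 <= j < k) (a * n%:R + b * k%:R + c * j%:R + u)) *
     bell n k (fun i => (i`!)%:R * x i).
Proof.
rewrite horner_comp horner_sum mulr_sumr; apply: eq_bigr => k _.
rewrite /bell egf_fact fps_expE hornerZ horner_comp hornerZ horner_prod.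
rewrite [RHS]mulrC -!mulrA; congr (_ * _); rewrite mulrCA; do 2!congr (_ * _).
by apply: eq_bigr => j _; rewrite !hornerE; ring.
Qed.

Lemma bell_transformE a b c d x n :
  bell_transform a b c d x n = (bell_family a b c x n).[d].
Proof.
apply: (mulfI (factr_neq0 K n)); rewrite horner_bell_family mulr_sumr.
by apply: eq_bigr => k _; rewrite -mulrA mulVKf // factr_neq0.
Qed.

(* At [u = d] only the term [k = 1] survives. *)
Lemma horner_bell_family_diag d x n : (0 < n)%N ->
  (bell_family 0 0 (- d) x n).[d] = x n.
Proof.
case: n => // n _; apply: (mulfI (factr_neq0 K n.+1)).
rewrite horner_bell_family big_nat_recl // big_geq // mul1r.
rewrite [X in _ + X]big_nat big1 => [|k /andP[k_gt0 _]].
  by rewrite addr0 /bell egf_fact fps_expE invr1 mul1r.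
by rewrite big_ltn // (_ : _ + d = 0) ?mul0r //; ring.
Qed.
End BellFamily.

Theorem theorem2p1 (R : realType) (a b c d : R[i]) (hc : c != 0)
    (x y : nat -> R[i])
    (hy : forall n : nat, (1 <= n)%N -> y n = bell_transform a b c d x n)
    (n : nat) (hn : (1 <= n)%N) (lambda : R[i]) :
  \sum_(1 <= k < n.+1)
     (\prod_(1 <= j < k) (lambda - d * j%:R + d)) *
     bell n k (fun i => (i`!)%:R * y i)
  = \sum_(1 <= k < n.+1)
     (\prod_(1 <= j < k) (a * n%:R + b * k%:R + c * j%:R + d + lambda)) *
     bell n k (fun i => (i`!)%:R * x i).
Proof.
have families_eq : bell_family 0 0 (- d) y n = bell_family a b c x n.
  apply: (@conv_type_eq_at _ d) n hn; try exact: conv_type_bell_family.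
  by move=> m m_gt0; rewrite horner_bell_family_diag // hy // bell_transformE.
transitivity ((n`!)%:R * (bell_family 0 0 (- d) y n).[d + lambda]).
  rewrite horner_bell_family; apply: eq_bigr => k _; congr (_ * _).
  by apply: eq_bigr => j _; ring.
rewrite families_eq horner_bell_family; apply: eq_bigr => k _; congr (_ * _).
by apply: eq_bigr => j _; rewrite addrA.
Qed.
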